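(* Let $G$ be a finite group with identity $e$, let $U$ be a projective unitary representation of $G$ on a finite-dimensional Hilbert space $\mathcal H$, and let $|\psi\rangle,|\phi\rangle\in\mathcal H$ be pure states. Assume that $L(\phi,g)=0$ holds only for $g=e$. Then \[ R_{\mathrm{ex}}(\psi\to\phi)=\begin{cases}\displaystyle\min_{g\in G\setminus(\{e\}\cup G_{\phi,\infty})}\frac{L(\psi,g)}{L(\phi,g)} & \text{if } G_{\phi,\infty}\subset G_{\psi,\infty},\\[2mm] 0 & \text{if } G_{\phi,\infty}\not\subset G_{\psi,\infty},\end{cases} \] with the convention that a ratio with numerator $+\infty$ and finite positive denominator equals $+\infty$.
   Context: A projective unitary representation $U$ of $G$ on $\mathcal H$ assigns a unitary $U(g)$ to each $g\in G$ with $U(g)U(g')=e^{i\omega(g,g')}U(gg')$ for phases $e^{i\omega(g,g')}$; write $\mathcal U_g(X)=U(g)XU(g)^\dagger$. On $\mathcal H^{\otimes n}$ one uses the representation $g\mapsto U(g)^{\otimes n}$. A CPTP map $\Lambda$ from a system with representation $\mathcal U_G$ to a system with representation $\mathcal U'_G$ is called covariant if $\mathcal U'_g\circ\Lambda=\Lambda\circ\mathcal U_g$ for all $g\in G$. For pure states, $\chi_\psi(g):=\langle\psi|U(g)|\psi\rangle$ is the characteristic function, $L(\psi,g):=-\log|\chi_\psi(g)|\in[0,\infty]$, and $G_{\psi,\infty}:=\{g\in G:\chi_\psi(g)=0\}$. The exact asymptotic conversion rate is $R_{\mathrm{ex}}(\psi\to\phi):=\sup\{r\ge 0:\exists N_0\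 \forall N>N_0\ \exists$ a covariant CPTP map $\Lambda$ (w.r.t. $U^{\otimes N}$ and $U^{\otimes \lfloor rN\rfloor}$) with $\Lambda(\psi^{\otimes N})=\phi^{\otimes\lfloor rN\rfloor}\}$, where $\psi=|\psi\rangle\langle\psi|$. *)

(* Defs.v *)
From HB Require Import structures.
From mathcomp Require Import all_boot all_order all_algebra all_fingroup.
From mathcomp Require Import complex mxtens.
From mathcomp Require Import all_classical all_reals ereal exp.
Set Implicit Arguments. Unset Strict Implicit. Unset Printing Implicit Defensive.
Import Order.TTheory GRing.Theory Num.Theory.
Local Open Scope ring_scope.
Local Open Scope classical_set_scope.

Section QRT.
Variable R : realType.
Local Notation C := R[i].

Definition adj m n (A : 'M[C]_(m, n)) : 'M[C]_(n, m) := (map_mx (@conjc R) A)^T.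

Definition psd n (X : 'M[C]_n) : Prop :=
  forall v : 'cV[C]_n, 0 <= (adj v *m X *m v) 0 0.

(* (Lambda (x) id_k) acting on 'M_(m*k) = 'M_m (x) 'M_k  (first factor = system) *)
Definition ampl m n k (Lam : 'M[C]_m -> 'M[C]_n) (X : 'M[C]_(m * k)) : 'M[C]_(n * k) :=
  \matrix_(p, q)
    Lam (\matrix_(a, b) X (mxtens_index (a, (mxtens_unindex p).2))
                          (mxtens_index (b, (mxtens_unindex q).2)))
        (mxtens_unindex p).1 (mxtens_unindex q).1.

Definition CPTP m n (Lam : {linear 'M[C]_m -> 'M[C]_n}) : Prop :=
  (forall X, \tr (Lam X) = \tr X) /\
  (forall k (X : 'M[C]_(m * k)), psd X -> psd (@ampl m n k Lam X)).

Definition proj_unitary_rep (gT : finGroupType) d (U : gT -> 'M[C]_d) : Prop :=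
  (forall g, U g *m adj (U g) = 1%:M /\ adj (U g) *m U g = 1%:M) /\
  (forall g h, exists w : C, `|w| = 1 /\ U g *m U h = w *: U (g * h)%g).

Definition covariant (gT : finGroupType) d (U : gT -> 'M[C]_d) N M
  (Lam : {linear 'M[C]_(d ^ N) -> 'M[C]_(d ^ M)}) : Prop :=
  forall g (X : 'M[C]_(d ^ N)),
    Lam (ntensmx (U g) N *m X *m adj (ntensmx (U g) N))
    = ntensmx (U g) M *m Lam X *m adj (ntensmx (U g) M).

Definition unit_vec d (psi : 'cV[C]_d) : Prop := (adj psi *m psi) 0 0 = 1.

Definition dens d (psi : 'cV[C]_d) : 'M[C]_d := psi *m adj psi.

Definition chi (gT : finGroupType) d (U : gT -> 'M[C]_d) (psi : 'cV[C]_d) g : C :=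
  (adj psi *m U g *m psi) 0 0.

(* L(psi,g) = - log (with `|z|` the modulus, a real number embedded in R[i]) |chi_psi(g)| in [0, +oo] *)
Definition Lfun (gT : finGroupType) d (U : gT -> 'M[C]_d) (psi : 'cV[C]_d) g : \bar R :=
  if chi U psi g == 0 then +oo%E else (- ln (complex.Re `|chi U psi g|))%:E.

Definition Ginf (gT : finGroupType) d (U : gT -> 'M[C]_d) (psi : 'cV[C]_d) : {set gT} :=
  [set g | chi U psi g == 0].

Definition achievable (gT : finGroupType) d (U : gT -> 'M[C]_d) (psi phi : 'cV[C]_d)
  (r : R) : Prop :=
  0 <= r /\ exists N0 : nat, forall N : nat, (N0 < N)%N ->
    exists Lam : {linear 'M[C]_(d ^ N) -> 'M[C]_(d ^ (Num.truncn (r * N%:R)))},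
      CPTP Lam /\ covariant U Lam /\
      Lam (ntensmx (dens psi) N) = ntensmx (dens phi) (Num.truncn (r * N%:R)).

Definition Rex (gT : finGroupType) d (U : gT -> 'M[C]_d) (psi phi : 'cV[C]_d) : \bar R :=
  ereal_sup [set r%:E | r in achievable U psi phi].

(* a/b with the convention +oo / (finite positive) = +oo *)
Definition eratio (a b : \bar R) : \bar R :=
  match a with
  | EFin x => (x / fine b)%:E
  | _ => a
  end.

End QRT.

(* Main.v *)
Require Import Defs.
From HB Require Import structures.
From mathcomp Require Import all_boot all_order all_algebra all_fingroup.
From mathcomp Require Import complex mxtens.
From mathcomp Require Import all_classical all_reals ereal exp.
From mathcomp Require Import ring lra.
Import Order.TTheory GRing.Theory Num.Theory.
Local Open Scope ring_scope.

Set Implicit Arguments.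
Unset Strict Implicit.
Unset Printing Implicit Defensive.

(** Converse: a covariant channel taking psi^N to phi^M also takes the rotated
    states U(g) psi^N to U(g) phi^M, and channels cannot decrease the overlap of
    two pure states, so |chi_psi(g)|^N <= |chi_phi(g)|^M.

    Achievability: let A and B be the Gram matrices of the orbits of psi^N and
    phi^M.  When r is below the minimum, the entrywise quotient A / B tends to
    the identity matrix, so for large N both A and A / B are strictly diagonally
    dominant.  Then A is invertible, i.e. the orbit of psi^N is linearly
    independent, and Schur multiplication by A / B in the dual basis is a channel
    between the two orbits.  Twirling it over G makes it covariant. *)

(** * Conjugate transposes and overlaps of unit vectors *)

Section Adjoint.
Variable R : realType.
Local Notation C := R[i].

Lemma hadjE m n (A : 'M[C]_(m, n)) i j : adj A i j = conjc (A j i).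
Proof. by rewrite !mxE. Qed.

Lemma hadjK m n (A : 'M[C]_(m, n)) : adj (adj A) = A.
Proof. by apply/matrixP=> i j; rewrite !hadjE conjcK. Qed.

Lemma hadjM m n p (A : 'M[C]_(m, n)) (B : 'M[C]_(n, p)) :
  adj (A *m B) = adj B *m adj A.
Proof. by rewrite /adj map_mxM trmx_mul. Qed.

Lemma hadjD m n (A B : 'M[C]_(m, n)) : adj (A + B) = adj A + adj B.
Proof. by rewrite /adj map_mxD linearD. Qed.

Lemma hadjB m n (A B : 'M[C]_(m, n)) : adj (A - B) = adj A - adj B.
Proof. by rewrite /adj map_mxB linearB. Qed.

Lemma hadjZ m n c (A : 'M[C]_(m, n)) : adj (c *: A) = conjc c *: adj A.
Proof. by rewrite /adj map_mxZ linearZ. Qed.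

Lemma hadj1 n : adj (1%:M : 'M[C]_n) = 1%:M.
Proof. by rewrite /adj map_mx1 trmx1. Qed.

Lemma hadj_tens m n p q (A : 'M[C]_(m, n)) (B : 'M[C]_(p, q)) :
  adj (A *t B) = adj A *t adj B.
Proof. by rewrite /adj map_mxT trmx_tens. Qed.

Lemma mul11E (A B : 'M[C]_1) : (A *m B) 0 0 = A 0 0 * B 0 0.
Proof. by rewrite mxE big_ord1. Qed.

Lemma conjc_overlap n (u v : 'cV[C]_n) :
  conjc ((adj u *m v) 0 0) = (adj v *m u) 0 0.
Proof. by rewrite -hadjE hadjM hadjK. Qed.

Lemma overlap_ge0 n (v : 'cV[C]_n) : 0 <= (adj v *m v) 0 0.
Proof.
by rewrite mxE sumr_ge0 // => i _; rewrite hadjE mulrC mulcJ_ge0.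
Qed.

Lemma dens_mul m n (A : 'M[C]_(m, n)) (v : 'cV[C]_n) :
  dens (A *m v) = A *m dens v *m adj A.
Proof. by rewrite /dens hadjM !mulmxA. Qed.

(** Cauchy-Schwarz: the squared norm of [v - c *: u], with [c] the overlap, is [1 - c * conjc c]. *)
Lemma norm_overlap_le1 n (u v : 'cV[C]_n) :
  unit_vec u -> unit_vec v -> `|(adj u *m v) 0 0| <= 1.
Proof.
move=> hu hv; set c := (adj u *m v) 0 0.
rewrite -(@expr_le1 _ 2) // -subr_ge0 sqr_normc.
have vu : conjc c = (adj v *m u) 0 0 by rewrite conjc_overlap.
suff <- : (adj (v - c *: u) *m (v - c *: u)) 0 0 = 1 - c * conjc c.
  exact: overlap_ge0.
rewrite hadjB hadjZ !(mulmxBl, mulmxBr) -!(scalemxAl, scalemxAr).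
have [e1 e2] : adj u *m u = 1%:M /\ adj v *m v = 1%:M.
  by split; rewrite [LHS]mx11_scalar ?hu ?hv.
have e3 : adj u *m v = c%:M by exact: mx11_scalar.
have e4 : adj v *m u = (conjc c)%:M by rewrite vu; exact: mx11_scalar.
rewrite e1 e2 e3 e4 !mxE eqxx !mulr1n mulr1 [conjc c * c]mulrC subrr.
by rewrite subr0.
Qed.

End Adjoint.

(** * Tensor powers of matrices and vectors *)

Section TensorPowers.
Variable R : realType.
Local Notation C := R[i].

Lemma ntensmx_mul m n p (A : 'M[C]_(m, n)) (B : 'M[C]_(n, p)) N :
  ntensmx (A *m B) N = ntensmx A N *m ntensmx B N.
Proof.
case: N => [|N]; first by rewrite !ntensmx0 mulmx1.
elim: N => [|N IH]; first by rewrite !ntensmx1.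
by rewrite !ntensmxSS IH tensmx_mul.
Qed.

Lemma hadj_ntensmx m n (A : 'M[C]_(m, n)) N :
  adj (ntensmx A N) = ntensmx (adj A) N.
Proof.
case: N => [|N]; first by rewrite !ntensmx0 hadj1.
elim: N => [|N IH]; first by rewrite !ntensmx1.
by rewrite !ntensmxSS -IH hadj_tens.
Qed.

Lemma ntensmxZ m n c (A : 'M[C]_(m, n)) N :
  ntensmx (c *: A) N = c ^+ N *: ntensmx A N.
Proof.
case: N => [|N]; first by rewrite !ntensmx0 expr0 scale1r.
elim: N => [|N IH]; first by rewrite !ntensmx1 expr1.
rewrite !ntensmxSS IH [c ^+ N.+2]exprS; apply/matrixP=> i j; rewrite !mxE.
by rewrite mulrACA.
Qed.

Lemma tensmx1 m n : (1%:M : 'M[C]_m) *t (1%:M : 'M[C]_n) = 1%:M.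
Proof.
apply/matrixP=> i j; case: (mxtens_indexP i) => a b.
case: (mxtens_indexP j) => a' b'; rewrite tensmxE !mxE -natrM mulnb.
by rewrite (inj_eq (can_inj (@mxtens_indexK m n))).
Qed.

Lemma ntensmx_id n N : ntensmx (1%:M : 'M[C]_n) N = 1%:M.
Proof.
case: N => [|N] //.
elim: N => [|N IH]; first by rewrite !ntensmx1.
by rewrite ntensmxSS IH tensmx1.
Qed.

(* [ntensmx v N] has [1 ^ N] columns, which is only propositionally 1. *)
Definition pvec d (v : 'cV[C]_d) N : 'cV[C]_(d ^ N) :=
  castmx (erefl, exp1n N) (ntensmx v N).

Lemma dens_pvec d (v : 'cV[C]_d) N : dens (pvec v N) = ntensmx (dens v) N.
Proof.
have dens_cast k (e : k = 1%N) (w : 'M[C]_(d ^ N, k)) :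
    dens (castmx (erefl, e) w) = w *m adj w.
  by subst k; rewrite castmx_id.
by rewrite dens_cast /dens ntensmx_mul hadj_ntensmx.
Qed.

(** Generalizing the column count [1 ^ N] to a variable [k] with [k = 1] removes the casts; what
    remains is the tensor power of a 1 by 1 matrix. *)
Lemma pvec_overlap d (v : 'cV[C]_d) (A : 'M[C]_d) N :
  (adj (pvec v N) *m ntensmx A N *m pvec v N) 0 0
  = ((adj v *m A *m v) 0 0) ^+ N.
Proof.
have e00 k (e : k = 1%N) (w : 'M[C]_(d ^ N, k)) (B : 'M[C]_(d ^ N)) :
    adj (castmx (erefl, e) w) *m B *m castmx (erefl, e) w
    = castmx (e, e) (adj w *m B *m w).
  by subst k; rewrite !castmx_id.
have e11 k (e : k = 1%N) c :
    (castmx (e, e) (c *: (1%:M : 'M[C]_k))) 0 0 = c.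
  by subst k; rewrite castmx_id !mxE mulr1.
rewrite e00 hadj_ntensmx -!ntensmx_mul [adj v *m A *m v]mx11_scalar.
by rewrite -scalemx1 ntensmxZ ntensmx_id e11 !mxE mulr1.
Qed.

Lemma unit_pvec d (v : 'cV[C]_d) N : unit_vec v -> unit_vec (pvec v N).
Proof.
move=> hv; rewrite /unit_vec.
have := pvec_overlap v 1%:M N; rewrite ntensmx_id !mulmx1 => ->.
by rewrite hv expr1n.
Qed.

End TensorPowers.

(** * Projective representations and characteristic functions *)

Section ProjectiveRepresentations.
Variables (R : realType) (gT : finGroupType).
Local Notation C := R[i].

Lemma proj_unitary_rep_ntensmx d (U : gT -> 'M[C]_d) N :
  proj_unitary_rep U -> proj_unitary_rep (fun g => ntensmx (U g) N).
Proof.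
move=> [hU hw]; split=> [g|g h].
  by rewrite hadj_ntensmx -!ntensmx_mul !(hU g).1 !(hU g).2 ntensmx_id.
have [w [w1 e]] := hw g h; exists (w ^+ N); rewrite normrX w1 expr1n.
by rewrite -ntensmx_mul e ntensmxZ.
Qed.

(** The adjoint of [U g] is [U g^-1] only up to a phase; the defining relation at the pair [g],
    [g^-1 * h] yields the phase directly. *)
Lemma proj_rep_div d (U : gT -> 'M[C]_d) g h : proj_unitary_rep U ->
  exists w : C, `|w| = 1 /\ adj (U g) *m U h = w *: U (g^-1 * h)%g.
Proof.
move=> [hU hw]; have [w [w1 e]] := hw g (g^-1 * h)%g.
rewrite mulKVg in e.
have w0 : w != 0 by rewrite -normr_eq0 w1 oner_eq0.
exists w^-1; rewrite normfV w1 invr1; split=> //.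
apply: (scalerI w0); rewrite scalerA divff // scale1r scalemxAr -e mulmxA.
by rewrite (hU g).2 mul1mx.
Qed.

(** Moduli remove the projective phase, so the characteristic function controls the Gram matrix of
    an orbit. *)
Lemma norm_rep_overlap d (U : gT -> 'M[C]_d) (v : 'cV[C]_d) g h :
  proj_unitary_rep U ->
  `|(adj (U g *m v) *m (U h *m v)) 0 0| = `|chi U v (g^-1 * h)%g|.
Proof.
move=> /(proj_rep_div g h) [w [w1 e]].
rewrite hadjM mulmxA -[adj v *m _ *m _]mulmxA e -scalemxAr -scalemxAl mxE.
by rewrite normrM w1 mul1r.
Qed.

Lemma conj_unit_scale n w (A X : 'M[C]_n) : `|w| = 1 ->
  (w *: A) *m X *m adj (w *: A) = A *m X *m adj A.
Proof.
move=> w1; rewrite hadjZ -!scalemxAl -scalemxAr scalerA -sqr_normc w1.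
by rewrite expr1n scale1r.
Qed.

Lemma unitary_unit_vec d (U : gT -> 'M[C]_d) (v : 'cV[C]_d) g :
  proj_unitary_rep U -> unit_vec v -> unit_vec (U g *m v).
Proof.
move=> [hU _] hv.
by rewrite /unit_vec hadjM mulmxA -[adj v *m _ *m _]mulmxA (hU g).2 mulmx1.
Qed.

Lemma norm_chi_le1 d (U : gT -> 'M[C]_d) (v : 'cV[C]_d) g :
  proj_unitary_rep U -> unit_vec v -> `|chi U v g| <= 1.
Proof.
move=> hU hv; rewrite /chi -mulmxA norm_overlap_le1 //.
exact: unitary_unit_vec.
Qed.

Lemma chi_pvec d (U : gT -> 'M[C]_d) (v : 'cV[C]_d) N g :
  chi (fun g => ntensmx (U g) N) (pvec v N) g = chi U v g ^+ N.
Proof. exact: pvec_overlap. Qed.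

End ProjectiveRepresentations.

(** * Complete positivity and monotonicity of pure-state overlaps *)

Section Converse.
Variable R : realType.
Local Notation C := R[i].

Lemma conjcM (x y : C) : conjc (x * y) = conjc x * conjc y.
Proof. exact: rmorphM. Qed.

Lemma conjcN (x : C) : conjc (- x) = - conjc x.
Proof. exact: rmorphN. Qed.

Lemma conjc_norm (x : C) : conjc `|x| = `|x|.
Proof. by rewrite normc_def conjc_real. Qed.

Lemma sum_mxtens m n (F : 'I_(m * n) -> C) :
  \sum_p F p = \sum_i \sum_j F (mxtens_index (i, j)).
Proof.
rewrite pair_big /= (reindex (@mxtens_index m n)) /=; last first.
  by exists (@mxtens_unindex m n) => p _; rewrite (mxtens_indexK, mxtens_unindexK).
by apply: eq_bigr => -[i j] _.
Qed.

Lemma formE m n (u : 'cV[C]_m) (v : 'cV[C]_n) (X : 'M[C]_(m, n)) :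
  (adj u *m X *m v) 0 0 = \sum_i \sum_j conjc (u i 0) * X i j * v j 0.
Proof.
rewrite mxE exchange_big /=; apply: eq_bigr => j _.
by rewrite mxE mulr_suml; apply: eq_bigr => i _; rewrite hadjE.
Qed.

Lemma form_delta m n (X : 'M[C]_(m, n)) i j :
  (adj (delta_mx i 0 : 'cV_m) *m X *m (delta_mx j 0 : 'cV_n)) 0 0 = X i j.
Proof.
rewrite formE (bigD1 i) //= [X in _ + X]big1 => [|l li]; last first.
  by rewrite big1 // => l' _; rewrite !mxE (negbTE li) conjc0 !mul0r.
rewrite addr0 (bigD1 j) //= big1 => [|l lj]; last first.
  by rewrite !mxE (negbTE lj) mulr0.
by rewrite !mxE !eqxx conjc1 mul1r mulr1 addr0.
Qed.

Lemma form_tensE n k (X : 'M[C]_(n * k)) (v : 'cV[C]_(n * k)) :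
  (adj v *m X *m v) 0 0 = \sum_(i < k) \sum_(j < k)
    \sum_(a < n) \sum_(b < n) conjc (v (mxtens_index (a, i)) 0)
      * X (mxtens_index (a, i)) (mxtens_index (b, j))
      * v (mxtens_index (b, j)) 0.
Proof.
rewrite formE sum_mxtens exchange_big /=; apply: eq_bigr => i _.
rewrite [RHS]exchange_big /=; apply: eq_bigr => a _.
by rewrite sum_mxtens exchange_big.
Qed.

Lemma psd_dens n (v : 'cV[C]_n) : psd (dens v).
Proof.
move=> u; rewrite /dens mulmxA -mulmxA mul11E -[(adj v *m u) 0 0]conjc_overlap.
exact: mulcJ_ge0.
Qed.

(** Apply the amplified map to the rank-one operator of the sum of the [y i] tensor [e_i], with
    [e_i] the ancilla basis, and test on the vector built likewise from the [x i]. *)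
Lemma CP_gram m n (Lam : 'M[C]_m -> 'M[C]_n) k
    (y : 'I_k -> 'cV[C]_m) (x : 'I_k -> 'cV[C]_n) :
  (forall X : 'M[C]_(m * k), psd X -> psd (ampl Lam X)) ->
  0 <= \sum_i \sum_j (adj (x i) *m Lam (y i *m adj (y j)) *m x j) 0 0.
Proof.
move=> hL.
pose st l (z : 'I_k -> 'cV[C]_l) : 'cV[C]_(l * k) :=
  \col_p z (mxtens_unindex p).2 (mxtens_unindex p).1 0.
have /(_ (st _ x)) := hL _ (psd_dens (st _ y)).
rewrite form_tensE; congr (0 <= _).
apply: eq_bigr => i _; apply: eq_bigr => j _; rewrite formE.
apply: eq_bigr => a _; apply: eq_bigr => b _.
rewrite !mxE !mxtens_indexK /=; congr (_ * Lam _ _ _ * _).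
by apply/matrixP=> c e; rewrite !mxE !big_ord1 !hadjE !mxE !mxtens_indexK.
Qed.

(** In [C], [0 <= z] also forces [z] to be real, and a real affine function bounded below is
    constant. Real and imaginary [t] then give enough linear equations to annihilate [a]. *)
Lemma affine_ge0 (c a b : C) :
  (forall t, 0 <= c + conjc t * a + t * b) -> a = 0.
Proof.
have real_affine (p q : R) : (forall s, 0 <= p + s * q) -> q = 0.
  move=> h; apply/eqP/negPn/negP => q0; have := h (- (p + 1) / q).
  by rewrite divfK //; lra.
case: c a b => [c1 c2] [a1 a2] [b1 b2] h.
have hre s : 0 <= c1 + s * (a1 + b1) /\ c2 + s * (a2 + b2) = 0.
  by have := h (Complex s 0); simpc => /andP[/eqP e1 e2]; split; lra.
have him s : 0 <= c1 + s * (a2 - b2) /\ c2 + s * (b1 - a1) = 0.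
  by have := h (Complex 0 s); simpc => /andP[/eqP e1 e2]; split; lra.
have e1 := real_affine _ _ (fun s => (hre s).1).
have e2 := real_affine _ _ (fun s => (him s).1).
have := (hre 0).2; have := (hre 1).2; have := (him 1).2 => e3 e4 e5.
by apply/eqP; rewrite eq_complex /=; apply/andP; split; apply/eqP; lra.
Qed.

(** Reality at [t = 1] and [t = i] forces [b = conjc a]; then [t = - (a / |a|)] leaves
    [2 - 2 |a|]. *)
Lemma hermitian_le1 (a b : C) :
  (forall t, `|t| = 1 -> 0 <= 1 + conjc t * a + t * b + 1) -> `|a| <= 1.
Proof.
move=> h.
have b_a : b = conjc a.
  have := h 1; have := h (Complex 0 1); rewrite conjc1 !mul1r normr1.
  have -> : `|Complex 0 1 : C| = 1 by rewrite normc_def /= expr0n add0r expr1n sqrtr1.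
  case: a b {h} => [a1 a2] [b1 b2] /(_ erefl) h1 /(_ erefl); move: h1; simpc.
  move=> /andP[/eqP e1 _] /andP[/eqP e2 _].
  by apply/eqP; rewrite eq_complex /=; apply/andP; split; apply/eqP; lra.
have [->|a0] := eqVneq a 0; first by rewrite normr0 ler01.
have na0 : `|a| != 0 by rewrite normr_eq0.
have := h (- (a / `|a|)); rewrite normrN normrM normfV normr_id divff //.
move=> /(_ erefl); rewrite b_a.
have -> : conjc (- (a / `|a|)) * a = - `|a|.
  rewrite conjcN conjcM conjc_inv conjc_norm.
  by rewrite mulNr mulrAC [conjc a * a]mulrC -sqr_normc expr2 mulfK.
have -> : - (a / `|a|) * conjc a = - `|a|.
  by rewrite mulNr mulrAC -sqr_normc expr2 mulfK.
have -> : 1 - `|a| - `|a| + 1 = (1 - `|a|) *+ 2 by ring.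
by rewrite pmulrn_lge0 // subr_ge0.
Qed.

(* Complete positivity on a two-level ancilla makes the block matrix of the
   images of the |v_i><v_j| positive; its diagonal blocks have rank one, which
   forces the off-diagonal block Z to be a multiple, by a factor of modulus at
   most 1, of w w'^*.  The trace of Z is preserved. *)
Lemma CPTP_overlap m n (Lam : {linear 'M[C]_m -> 'M[C]_n})
    (v v' : 'cV[C]_m) (w w' : 'cV[C]_n) :
  CPTP Lam -> unit_vec w -> unit_vec w' ->
  Lam (dens v) = dens w -> Lam (dens v') = dens w' ->
  `|(adj v *m v') 0 0| <= `|(adj w *m w') 0 0|.
Proof.
move=> [hTr hCP] hw hw' hv hv'.
pose Z := Lam (v *m adj v'); pose Z' := Lam (v' *m adj v).
have gram (u u' : 'cV[C]_n) : 0 <= (adj u *m dens w *m u) 0 0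
    + (adj u *m Z *m u') 0 0 + (adj u' *m Z' *m u) 0 0
    + (adj u' *m dens w' *m u') 0 0.
  have := CP_gram (fun i : 'I_2 => if i == 0 then v else v')
                  (fun i : 'I_2 => if i == 0 then u else u') (hCP 2).
  by rewrite !big_ord_recl !big_ord0 /= !addr0 hv hv' !addrA.
have formZl (t : C) (u u' : 'cV[C]_n) X :
    (adj (t *: u) *m X *m u') 0 0 = conjc t * (adj u *m X *m u') 0 0.
  by rewrite hadjZ -!scalemxAl mxE.
have formZr (t : C) (u u' : 'cV[C]_n) X :
    (adj u *m X *m (t *: u')) 0 0 = t * (adj u *m X *m u') 0 0.
  by rewrite -scalemxAr mxE.
have form0 (u z : 'cV[C]_n) : (adj z *m u) 0 0 = 0 ->
    (adj u *m dens z *m u) 0 0 = 0.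
  by move=> h; rewrite /dens mulmxA -mulmxA mul11E h mulr0.
(* For [u'] orthogonal to [w'] the last diagonal term vanishes, and rescaling [u'] leaves an
   expression affine in [t]. [Zl] is the mirror image. *)
have Zr (u u' : 'cV[C]_n) : (adj w' *m u') 0 0 = 0 -> (adj u *m Z *m u') 0 0 = 0.
  move=> h.
  apply: (@affine_ge0 ((adj u *m dens w *m u) 0 0) _ ((adj u' *m Z' *m u) 0 0)).
  move=> t; have := gram u (conjc t *: u').
  rewrite [X in _ <= _ + X](form0 (conjc t *: u') w'); last first.
    by rewrite -scalemxAr mxE h mulr0.
  by rewrite addr0 formZl formZr conjcK.
have Zl (u u' : 'cV[C]_n) : (adj w *m u) 0 0 = 0 -> (adj u *m Z *m u') 0 0 = 0.
  move=> h.
  apply: (@affine_ge0 ((adj u' *m dens w' *m u') 0 0) _ ((adj u' *m Z' *m u) 0 0)).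
  move=> t; have := gram (t *: u) u'.
  rewrite [X in _ <= X + _ + _ + _](form0 (t *: u) w); last first.
    by rewrite -scalemxAr mxE h mulr0.
  by rewrite add0r formZl formZr addrC addrA.
have ww : adj w *m w = 1%:M by rewrite [LHS]mx11_scalar hw.
have ww' : adj w' *m w' = 1%:M by rewrite [LHS]mx11_scalar hw'.
have denw (z : 'cV[C]_n) : unit_vec z -> (adj z *m dens z *m z) 0 0 = 1.
  by move=> h; rewrite /dens mulmxA -mulmxA mul11E h mulr1.
have mx0 (X : 'M[C]_n) :
    (forall u u' : 'cV[C]_n, (adj u *m X *m u') 0 0 = 0) -> X = 0.
  by move=> h; apply/matrixP=> i j; rewrite mxE -form_delta h.
have eZr : Z = Z *m dens w'.
  apply/eqP; rewrite -subr_eq0 -{1}[Z]mulmx1 -mulmxBr; apply/eqP/mx0 => u u'.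
  rewrite mulmxA -mulmxA Zr // mulmxA mulmxBr mulmx1 /dens mulmxA ww' mul1mx.
  by rewrite subrr mul0mx mxE.
have eZl : Z = dens w *m Z.
  apply/eqP; rewrite -subr_eq0 -{1}[Z]mul1mx -mulmxBl; apply/eqP/mx0 => u u'.
  have -> : adj u *m ((1%:M - dens w) *m Z) *m u'
      = adj ((1%:M - dens w) *m u) *m Z *m u'.
    by rewrite hadjM hadjB hadj1 /dens hadjM hadjK !mulmxA.
  apply: Zl; rewrite mulmxA mulmxBr mulmx1 /dens mulmxA ww mul1mx.
  by rewrite subrr mul0mx mxE.
have trcol (x y : 'cV[C]_n) : \tr (x *m adj y) = (adj y *m x) 0 0.
  by rewrite mxtrace_mulC /mxtrace big_ord1.
have trcolm (x y : 'cV[C]_m) : \tr (x *m adj y) = (adj y *m x) 0 0.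
  by rewrite mxtrace_mulC /mxtrace big_ord1.
have -> : (adj v *m v') 0 0 = conjc (\tr Z).
  by rewrite /Z hTr trcolm conjc_overlap.
set a := (adj w *m Z *m w') 0 0.
have -> : Z = a *: (w *m adj w').
  rewrite {1}eZr {1}eZl /dens !mulmxA -[w *m _ *m Z]mulmxA.
  by rewrite -[w *m _ *m w']mulmxA [_ *m w']mx11_scalar mul_mx_scalar -scalemxAl.
rewrite normcJ linearZ /= trcol normrM -[(adj w' *m w) 0 0]conjc_overlap normcJ.
(* Testing on [t *: w] and [w'] makes both diagonal terms 1, which bounds the coefficient [a]. *)
rewrite ler_piMl //; apply: (hermitian_le1 (b := (adj w' *m Z' *m w) 0 0)) => t t1.
have := gram (t *: w) w'.
rewrite !(formZl, formZr) mulrA [conjc t * t]mulrC -sqr_normc t1 expr1n mul1r.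
by rewrite !denw.
Qed.
End Converse.

(** * Constructions of completely positive maps *)

Section Direct.
Variable R : realType.
Local Notation C := R[i].

Definition CP m n (F : 'M[C]_m -> 'M[C]_n) :=
  forall k (X : 'M[C]_(m * k)), psd X -> psd (ampl F X).

Lemma psd_conj m n (K : 'M[C]_(n, m)) (X : 'M[C]_m) :
  psd X -> psd (K *m X *m adj K).
Proof.
by move=> hX v; have := hX (adj K *m v); rewrite hadjM hadjK !mulmxA.
Qed.

(** The amplification is conjugation by [K] tensor the identity. *)
Lemma CP_conj m n (K : 'M[C]_(n, m)) : CP (fun X => K *m X *m adj K).
Proof.
move=> k X /(psd_conj (K *t (1%:M : 'M_k))); congr psd.
apply/matrixP=> p q; case: (mxtens_indexP p) => a i.
case: (mxtens_indexP q) => b j; rewrite hadj_tens hadj1 [RHS]mxE.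
rewrite !mxtens_indexK /= [RHS]mxE [LHS]mxE sum_mxtens; apply: eq_bigr => c _.
rewrite (bigD1 j) //= big1 ?addr0 => [|l lj]; last first.
  by rewrite tensmxE [(1%:M : 'M_k) _ _]mxE (negbTE lj) !mulr0.
rewrite tensmxE [(1%:M : 'M_k) _ _]mxE eqxx mulr1; congr (_ * _).
rewrite mxE [RHS]mxE sum_mxtens; apply: eq_bigr => e _.
rewrite (bigD1 i) //= big1 ?addr0 => [|l li]; last first.
  by rewrite tensmxE [(1%:M : 'M_k) _ _]mxE eq_sym (negbTE li) mulr0 mul0r.
by rewrite tensmxE [(1%:M : 'M_k) _ _]mxE eqxx mulr1 mxE.
Qed.

Lemma CP_comp m n p (F : 'M[C]_n -> 'M[C]_p) (H : 'M[C]_m -> 'M[C]_n) :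
  CP F -> CP H -> CP (fun X => F (H X)).
Proof.
move=> hF hH k X /(hH k)/(hF k); congr psd.
apply/matrixP=> p' q'; rewrite !mxE; congr (F _ _ _).
by apply/matrixP=> a b; rewrite !mxE !mxtens_indexK.
Qed.

Lemma psdD n (X Y : 'M[C]_n) : psd X -> psd Y -> psd (X + Y).
Proof.
by move=> hX hY v; rewrite mulmxDr mulmxDl mxE addr_ge0.
Qed.

Lemma CP_add m n (F H : 'M[C]_m -> 'M[C]_n) :
  CP F -> CP H -> CP (fun X => F X + H X).
Proof.
move=> hF hH k X hX; have := psdD (hF k X hX) (hH k X hX); congr psd.
by apply/matrixP=> p q; rewrite !mxE.
Qed.

Lemma CP_sum m n (I : finType) (F : I -> 'M[C]_m -> 'M[C]_n) :
  (forall i, CP (F i)) -> CP (fun X => \sum_i F i X).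
Proof.
move=> hF k X hX v.
have -> : ampl (fun X => \sum_i F i X) X = \sum_i ampl (F i) X.
  apply/matrixP=> p q; rewrite mxE !summxE; apply: eq_bigr => i _.
  by rewrite mxE.
rewrite mulmx_sumr mulmx_suml summxE sumr_ge0 // => i _.
exact: hF.
Qed.

Lemma CP_scale m n c (F : 'M[C]_m -> 'M[C]_n) :
  0 <= c -> CP F -> CP (fun X => c *: F X).
Proof.
move=> c0 hF k X /(hF k) hX v.
have -> : ampl (fun X => c *: F X) X = c *: ampl F X.
  by apply/matrixP=> p q; rewrite !mxE.
by rewrite -scalemxAr -scalemxAl mxE mulr_ge0.
Qed.

(** The Kraus operators are [t *m adj e_j], with [e_j] the standard basis. *)
Lemma CP_trace m n (t : 'cV[C]_n) : CP (fun X : 'M[C]_m => \tr X *: dens t).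
Proof.
have -> : (fun X : 'M[C]_m => \tr X *: dens t) = fun X =>
    \sum_j (t *m adj (delta_mx j 0)) *m X *m adj (t *m adj (delta_mx j 0)).
  apply/funext => X; rewrite scaler_suml; apply: eq_bigr => j _.
  rewrite hadjM hadjK mulmxA -[t *m _ *m X]mulmxA -[t *m _ *m delta_mx _ _]mulmxA.
  by rewrite [_ *m delta_mx _ _]mx11_scalar form_delta mul_mx_scalar -scalemxAl.
by apply: CP_sum => j; exact: CP_conj.
Qed.

(** Testing [Q] on [e_i + u e_j], with [u] the phase of [W i j], bounds the terms at [(i, j)] and
    [(j, i)] together from below by [- |W i j| (Q i i + Q j j)]. This serves both Schur multipliers
    and invertibility. *)
Lemma diag_dominant_le k (W Q : 'M[C]_k) :
  (forall i j, W j i = conjc (W i j)) -> psd Q ->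
  \sum_i (W i i - \sum_(j | j != i) `|W i j|) * Q i i
    <= \sum_i \sum_j W i j * Q i j.
Proof.
move=> hW hQ.
have h2 i j u : `|u| = 1 :> C ->
    0 <= Q i i + u * Q i j + conjc u * Q j i + Q j j.
  move=> u1; have := hQ (delta_mx i 0 + u *: delta_mx j 0).
  have addE (A B : 'M[C]_1) : (A + B) 0 0 = A 0 0 + B 0 0 by rewrite mxE.
  have scaleE c (A : 'M[C]_1) : (c *: A) 0 0 = c * A 0 0 by rewrite mxE.
  rewrite hadjD hadjZ !mulmxDl !mulmxDr -!scalemxAl -!scalemxAr !(addE, scaleE).
  have uu : u * conjc u = 1 by rewrite -sqr_normc u1 expr1n.
  by rewrite !form_delta; congr (0 <= _); rewrite -[in RHS](mul1r (Q j j)) -uu; ring.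
pose E i j := W i j * Q i j + `|W i j| * Q i i.
have hE i j : 0 <= E i j + E j i.
  rewrite /E (hW i j) normcJ.
  have [->|w0] := eqVneq (W i j) 0.
    by rewrite conjc0 normr0 !mul0r !addr0.
  have nw0 : `|W i j| != 0 by rewrite normr_eq0.
  have := h2 i j (W i j / `|W i j|).
  rewrite normrM normfV normr_id divff // => /(_ erefl) /(mulr_ge0 (normr_ge0 (W i j))).
  rewrite conjcM conjc_inv conjc_norm; congr (0 <= _).
  by field.
have hsym : \sum_i \sum_(j | j != i) E j i = \sum_i \sum_(j | j != i) E i j.
  rewrite (exchange_big_dep xpredT) //=; apply: eq_bigr => i _.
  by apply: eq_bigl => j; rewrite eq_sym.
rewrite -subr_ge0.
have -> : \sum_i \sum_j W i j * Q i j
    - \sum_i (W i i - \sum_(j | j != i) `|W i j|) * Q i i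
    = \sum_i \sum_(j | j != i) E i j.
  rewrite -sumrB; apply: eq_bigr => i _; rewrite (bigD1 i) //= big_split /=.
  by rewrite -mulr_suml; ring.
(* Doubling the sum pairs [E i j] with [E j i]; only their sum is known to be nonnegative. *)
rewrite -(pmulrn_lge0 _ (isT : (0 < 2)%N)) mulr2n -{1}hsym -big_split /=.
by apply: sumr_ge0 => i _; rewrite -big_split /=; apply: sumr_ge0 => j _; exact: hE.
Qed.

(** Contracting the ancilla with the test vector leaves a positive [k] by [k] matrix [Q], and the
    form becomes the sum of the [W i j * Q i j]. *)
Lemma CP_schur k (W : 'M[C]_k) :
  (forall i j, W j i = conjc (W i j)) ->
  (forall i, \sum_(j | j != i) `|W i j| <= W i i) ->
  CP (fun X => \matrix_(i, j) (W i j * X i j)).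
Proof.
move=> hW hd l X hX v.
pose vt (i : 'I_k) p := v (mxtens_index (i, p)) 0.
pose Q : 'M[C]_k := \matrix_(i, j) \sum_p \sum_q
  conjc (vt i p) * X (mxtens_index (i, p)) (mxtens_index (j, q)) * vt j q.
have unindex1 (i : 'I_k) (p : 'I_l) :
    Ordinal (mxtens_index_proof1 (mxtens_index (i, p))) = i.
  exact: (congr1 fst (mxtens_indexK (i, p))).
have psdQ : psd Q.
  (* The form of [Q] at [y] is that of [X] at [v] with its [i]-th block scaled by [y i 0]. *)
  move=> y; have := hX (\col_p (v p 0 * y (mxtens_unindex p).1 0)).
  rewrite !formE sum_mxtens; congr (0 <= _); apply: eq_bigr => i _.
  under eq_bigr do rewrite sum_mxtens.
  rewrite exchange_big /=; apply: eq_bigr => j _; rewrite mxE.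
  rewrite mulr_sumr mulr_suml; apply: eq_bigr => p _.
  rewrite mulr_sumr mulr_suml; apply: eq_bigr => q _.
  by rewrite !mxE !unindex1 conjcM /vt; ring.
have := diag_dominant_le hW psdQ.
have -> : \sum_i \sum_j W i j * Q i j
    = (adj v *m ampl (fun X => \matrix_(i, j) (W i j * X i j)) X *m v) 0 0.
  rewrite formE sum_mxtens; apply: eq_bigr => i _.
  under [RHS]eq_bigr do rewrite sum_mxtens.
  rewrite [RHS]exchange_big /=; apply: eq_bigr => j _; rewrite mxE mulr_sumr.
  apply: eq_bigr => p _; rewrite mulr_sumr; apply: eq_bigr => q _.
  by rewrite !mxE !mxtens_indexK /= /vt; ring.
apply: le_trans; apply: sumr_ge0 => i _; rewrite mulr_ge0 ?subr_ge0 //.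
by rewrite -(form_delta Q).
Qed.

End Direct.

(** * Channels between families of pure states, and twirling *)

Section GramChannel.
Variable R : realType.
Local Notation C := R[i].

Lemma linear_pack m n (f : 'M[C]_m -> 'M[C]_n) : linear f ->
  exists L : {linear 'M[C]_m -> 'M[C]_n}, forall X, L X = f X.
Proof.
move=> hf; pose L : {linear 'M[C]_m -> 'M[C]_n} :=
  HB.pack f (GRing.isLinear.Build C _ _ _ f hf).
by exists L.
Qed.

Lemma CP_ext m n (f g : 'M[C]_m -> 'M[C]_n) : f =1 g -> CP f -> CP g.
Proof. by move=> /funext ->. Qed.

(** There are [k - 1] terms of at most [1 / k]; the omitted index supplies the strict gap. *)
Lemma sum_off_lt1 k (F : 'I_k -> C) i :
  (forall j, j != i -> F j <= k%:R^-1) -> \sum_(j | j != i) F j < 1.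
Proof.
move=> hF; have k0 : (0 < k)%N by case: k i {F hF} => [[]|].
have k0' : (k%:R : C) != 0 by rewrite pnatr_eq0 -lt0n.
have -> : 1 = \sum_(j : 'I_k) (k%:R^-1 : C).
  by rewrite sumr_const card_ord -[RHS]mulr_natl divff.
rewrite [ltRHS](bigD1 i) //= -[ltLHS]add0r ltr_leD ?invr_gt0 ?ltr0n //.
exact: ler_sum.
Qed.

(** For [u] in the left kernel, [diag_dominant_le] at the rank-one matrix of [u] bounds a sum of
    positive multiples of the [|u_i|^2] by [u *m A *m adj u], which is 0. *)
Lemma diag_dominant_unitmx k (A : 'M[C]_k) :
  (forall i j, A j i = conjc (A i j)) ->
  (forall i, \sum_(j | j != i) `|A i j| < A i i) -> A \in unitmx.
Proof.
move=> hA hd; rewrite -row_free_unit -kermx_eq0.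
apply/eqP/row_matrixP => l; rewrite row0.
have : row l (kermx A) *m A = 0 by rewrite -row_mul mulmx_ker row0.
move: (row _ _) => u uA.
have := diag_dominant_le hA (psd_dens u^T).
have -> : \sum_i \sum_j A i j * dens u^T i j = (u *m A *m adj u) 0 0.
  rewrite mxE exchange_big /=; apply: eq_bigr => j _.
  rewrite [in RHS]mxE mulr_suml; apply: eq_bigr => i _.
  by rewrite !mxE big_ord1 !mxE; ring.
have dE i : dens u^T i i = u 0 i * conjc (u 0 i).
  by rewrite !mxE big_ord1 !mxE.
rewrite uA mul0mx mxE => hle.
have t0 i : 0 <= (A i i - \sum_(j | j != i) `|A i j|) * dens u^T i i.
  by rewrite dE mulr_ge0 ?mulcJ_ge0 // subr_ge0 ltW.
have := le_anti (introT andP (conj hle (sumr_ge0 _ (fun i _ => t0 i)))).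
move=> /(psumr_eq0P (fun i _ => t0 i)) h; apply/rowP=> i; rewrite mxE.
have /eqP := h i isT; rewrite mulf_eq0 subr_eq0 gt_eqF //= dE -sqr_normc.
by rewrite expf_eq0 normr_eq0 => /eqP.
Qed.

(* The hypothesis makes A / B diagonally dominant (A and B are the two Gram
   matrices); it also gives A_ij = 0 when B_ij = 0, so the junk value of the
   division there is harmless. *)
Lemma gram_channel m n k (s : 'I_k -> 'cV[C]_m) (t : 'I_k -> 'cV[C]_n) (i0 : 'I_k) :
  (forall i, unit_vec (s i)) -> (forall i, unit_vec (t i)) ->
  (forall i j, i != j ->
    k%:R * `|(adj (s i) *m s j) 0 0| <= `|(adj (t i) *m t j) 0 0|) ->
  exists Lam : {linear 'M[C]_m -> 'M[C]_n},
    CPTP Lam /\ forall i, Lam (dens (s i)) = dens (t i).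
Proof.
move=> hs ht hst.
pose S : 'M[C]_(m, k) := \matrix_(a, i) s i a 0.
pose T : 'M[C]_(n, k) := \matrix_(a, i) t i a 0.
pose A := adj S *m S; pose B := adj T *m T.
have AE i j : A i j = (adj (s i) *m s j) 0 0.
  by rewrite !mxE; apply: eq_bigr => a _; rewrite !mxE.
have BE i j : B i j = (adj (t i) *m t j) 0 0.
  by rewrite !mxE; apply: eq_bigr => a _; rewrite !mxE.
have hA i j : A j i = conjc (A i j) by rewrite !AE conjc_overlap.
have hB i j : B j i = conjc (B i j) by rewrite !BE conjc_overlap.
have k0 : (0 : C) < k%:R by rewrite ltr0n; case: k i0 {s t hs ht hst S T A B AE BE hA hB} => [[]|].
have hAB i j : i != j -> `|A i j| <= k%:R^-1 * `|B i j|.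
  by move=> ij; rewrite ler_pdivlMl // AE BE hst.
have B0 i j : B i j = 0 -> A i j = 0.
  have [<-|ij] := eqVneq i j.
    by rewrite BE ht => /eqP; rewrite oner_eq0.
  move=> b0; have := hAB _ _ ij; rewrite b0 normr0 mulr0 normr_le0.
  by move/eqP.
have A1 i : A i i = 1 by rewrite AE hs.
have uA : A \in unitmx.
  apply: diag_dominant_unitmx hA _ => i; rewrite A1; apply: sum_off_lt1 => j ji.
  apply: (le_trans (hAB i j _)); first by rewrite eq_sym.
  rewrite ler_piMr ?invr_ge0 ?(ltW k0) // BE.
  exact: norm_overlap_le1.
(* Transposed, so that tr (T^* T (W o Y)) = tr (A Y). *)
pose W : 'M[C]_k := \matrix_(i, j) (A j i / B j i).
have WE i j : W i j = A j i / B j i by rewrite mxE.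
have W1 i : W i i = 1 by rewrite WE A1 BE ht divr1.
have CPW : CP (fun X => \matrix_(i, j) (W i j * X i j)).
  apply: CP_schur => [i j|i].
    by rewrite !WE conjcM conjc_inv -hA -hB.
  rewrite W1 ltW //; apply: sum_off_lt1 => j ji; rewrite WE normrM normfV.
  have [->|b0] := eqVneq (B j i) 0.
    by rewrite normr0 invr0 mulr0 invr_ge0 ltW.
  by rewrite ler_pdivrMr ?normr_gt0 // hAB.
have adjA : adj A = A by rewrite hadjM hadjK.
have adjAV : adj (invmx A) = invmx A by rewrite /adj map_invmx trmx_inv -/(adj A) adjA.
(* The rows of D form the dual basis of the s_i. *)
pose D := invmx A *m adj S.
have DS : D *m S = 1%:M by rewrite -mulmxA mulVmx.
have AD : A *m D = adj S by rewrite mulmxA mulmxV // mul1mx.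
have adjD : adj D = S *m invmx A by rewrite hadjM hadjK adjAV.
(* [P] is the orthogonal projection onto the span of the [s i]. *)
pose P := S *m D.
have adjP : adj P = P by rewrite hadjM adjD -mulmxA.
have PP : P *m P = P by rewrite /P mulmxA -[S *m D *m S]mulmxA DS mulmx1.
(* Off the span of the s_i, the channel just prepares t_i0. *)
pose Q := 1%:M - P.
have adjQ : adj Q = Q by rewrite hadjB hadj1 adjP.
have QQ : Q *m Q = Q.
  by rewrite {1}/Q mulmxBl mul1mx {2}/Q mulmxBr mulmx1 PP subrr subr0.
pose sch (X : 'M[C]_k) := \matrix_(i, j) (W i j * X i j).
(* The first term sends [s i *m adj (s j)] to [W i j] times [t i *m adj (t j)]; the second restores
   the trace. *)
pose f X := T *m sch (D *m X *m adj D) *m adj T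
  + \tr (Q *m X *m adj Q) *: dens (t i0).
have [|Lam LamE] := linear_pack (f := f).
  move=> a X Y; rewrite /f.
  have schD U V : sch (a *: U + V) = a *: sch U + sch V.
    by apply/matrixP=> i j; rewrite !mxE; ring.
  have sandwichD p q (K : 'M[C]_(p, q)) (L : 'M[C]_(q, p)) b U Z :
      K *m (b *: U + Z) *m L = b *: (K *m U *m L) + K *m Z *m L.
    by rewrite mulmxDr mulmxDl -scalemxAr -scalemxAl.
  rewrite !sandwichD schD sandwichD mxtraceD mxtraceZ scalerDl scalerDr scalerA.
  by rewrite addrACA.
exists Lam; split; first split.
- move=> X; rewrite LamE mxtraceD mxtraceZ.
  have -> : \tr (dens (t i0)) = 1.
    by rewrite mxtrace_mulC /mxtrace big_ord1 -[RHS](ht i0).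
  have -> : \tr (T *m sch (D *m X *m adj D) *m adj T) = \tr (P *m X).
    rewrite mxtrace_mulC mulmxA.
    (* Since [B i j * W j i = A i j], the multiplier trades the Gram matrix of the [t i] for that of
       the [s i]. *)
    transitivity (\tr (A *m (D *m X *m adj D))).
      rewrite /mxtrace; apply: eq_bigr => i _; rewrite [LHS]mxE [RHS]mxE.
      apply: eq_bigr => j _; rewrite -/B [sch _ _ _]mxE WE.
      have [b0|b0] := eqVneq (B i j) 0; first by rewrite b0 B0 // !mul0r.
      by rewrite mulrA mulrCA divff // mulr1.
    rewrite mulmxA [A *m (D *m X)]mulmxA AD mxtrace_mulC mulmxA adjD.
    by rewrite -[S *m _ *m adj S]mulmxA.
  have -> : \tr (Q *m X *m adj Q) = \tr (Q *m X).
    by rewrite mxtrace_mulC adjQ mulmxA QQ.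
  by rewrite mulr1 -mxtraceD -mulmxDl addrC subrK mul1mx.
- move=> l; apply: (CP_ext (f := f)) => [X|]; first by rewrite LamE.
  apply: CP_add.
    by apply: (CP_comp (CP_conj T)); apply: (CP_comp CPW); exact: CP_conj.
  exact: (CP_comp (@CP_trace _ m n (t i0)) (CP_conj Q)).
- move=> l; have sE : s l = S *m delta_mx l 0.
    by rewrite -colE; apply/colP => a; rewrite !mxE.
  have tE : t l = T *m delta_mx l 0.
    by rewrite -colE; apply/colP => a; rewrite !mxE.
  have Ds : D *m s l = delta_mx l 0 by rewrite sE mulmxA DS mul1mx.
  have Qs : Q *m s l = 0.
    by rewrite mulmxBl mul1mx -mulmxA Ds -sE subrr.
  rewrite LamE /f -!dens_mul Ds Qs {2}/dens mul0mx mxtrace0 scale0r addr0.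
  rewrite tE dens_mul; congr (_ *m _ *m _); apply/matrixP => i j.
  rewrite [LHS]mxE; have -> : dens (delta_mx l 0 : 'cV[C]_k) i j
      = (i == l)%:R * (j == l)%:R.
    by rewrite /dens mxE big_ord1 hadjE !mxE !eqxx !andbT conjc_nat.
  have [->|] := eqVneq i l; last by rewrite !mul0r mulr0.
  have [->|] := eqVneq j l; last by rewrite !mulr0.
  by rewrite W1 mul1r.
Qed.

(** Averaging over the group works because conjugation ignores phases; at [rho], the orbit
    hypothesis makes every averaged term equal to [sigma]. *)
Lemma twirl (gT : finGroupType) m n (V : gT -> 'M[C]_m) (V' : gT -> 'M[C]_n)
    (Lam : {linear 'M[C]_m -> 'M[C]_n}) (rho : 'M[C]_m) (sigma : 'M[C]_n) :
  proj_unitary_rep V -> proj_unitary_rep V' -> CPTP Lam ->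
  (forall g, Lam (V g *m rho *m adj (V g)) = V' g *m sigma *m adj (V' g)) ->
  exists Lam' : {linear 'M[C]_m -> 'M[C]_n},
    [/\ CPTP Lam', Lam' rho = sigma & forall g X,
      Lam' (V g *m X *m adj (V g)) = V' g *m Lam' X *m adj (V' g)].
Proof.
move=> [hV hVw] [hV' hVw'] [hTr hCP] hrho.
have hG : (#|gT|%:R : C) != 0 by rewrite pnatr_eq0 -lt0n; apply/card_gt0P; exists 1%g.
pose f X := #|gT|%:R^-1 *:
  \sum_g adj (V' g) *m Lam (V g *m X *m adj (V g)) *m adj (adj (V' g)).
have [|Lam' LamE] := linear_pack (f := f).
  move=> a X Y; rewrite /f scalerA mulrC -scalerA -scalerDr; congr (_ *: _).
  rewrite scaler_sumr -big_split /=; apply: eq_bigr => g _.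
  rewrite mulmxDr mulmxDl -scalemxAr -scalemxAl linearP mulmxDr mulmxDl.
  by rewrite -scalemxAr -scalemxAl.
have avg (Z : 'M[C]_n) : #|gT|%:R^-1 *: \sum_(g : gT) Z = Z.
  by rewrite sumr_const -[Z *+ _]scaler_nat scalerA mulVf // scale1r.
exists Lam'; split; first split.
- move=> X; rewrite LamE linearZ /= linear_sum /=.
  under eq_bigr => g _.
    rewrite hadjK mxtrace_mulC mulmxA (hV' g).1 mul1mx hTr.
    rewrite mxtrace_mulC mulmxA (hV g).2 mul1mx; over.
  by rewrite sumr_const -[\tr X *+ _]mulr_natl mulKf.
- move=> k; apply: (CP_ext (f := f)) => [X|]; first by rewrite LamE.
  apply: CP_scale; first by rewrite invr_ge0 ler0n.
  apply: CP_sum => g; apply: (CP_comp (CP_conj (adj (V' g)))).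
  by apply: (CP_comp hCP); exact: CP_conj.
- rewrite LamE /f -[RHS]avg; congr (_ *: _); apply: eq_bigr => g _.
  rewrite hrho hadjK !mulmxA (hV' g).2 mul1mx -mulmxA (hV' g).2.
  by rewrite mulmx1.
- move=> h X; rewrite !LamE /f -scalemxAr -scalemxAl; congr (_ *: _).
  (* Right translation by [h] matches the two sums termwise, up to phases that conjugation
     cancels. *)
  rewrite mulmx_sumr mulmx_suml [RHS](reindex_inj (mulIg h)) /=.
  apply: eq_bigr => g _.
  have [w [w1 e]] := hVw g h; have [w' [w1' e']] := hVw' g h.
  have -> : V g *m (V h *m X *m adj (V h)) *m adj (V g)
      = V (g * h)%g *m X *m adj (V (g * h)%g).
    by rewrite -[RHS](conj_unit_scale _ _ w1) -e hadjM !mulmxA.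
  have -> : V' h *m (adj (V' (g * h)%g) *m Lam (V (g * h)%g *m X *m adj (V (g * h)%g))
        *m adj (adj (V' (g * h)%g))) *m adj (V' h)
      = (V' h *m adj (V' (g * h)%g)) *m Lam (V (g * h)%g *m X *m adj (V (g * h)%g))
        *m adj (V' h *m adj (V' (g * h)%g)).
    by rewrite hadjM !mulmxA.
  have hw : conjc w' *: (V' h *m adj (V' (g * h)%g)) = adj (V' g).
    by rewrite scalemxAr -hadjZ -e' hadjM mulmxA (hV' h).1 mul1mx.
  rewrite -[RHS](conj_unit_scale (w := conjc w')) ?normcJ //.
  by rewrite hw.
Qed.
End GramChannel.

(** * Conversion with fixed numbers of copies *)

Section Conversion.
Variables (R : realType) (gT : finGroupType) (d : nat).
Variables (U : gT -> 'M[R[i]]_d) (psi phi : 'cV[R[i]]_d).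
Hypotheses (hU : proj_unitary_rep U) (hpsi : unit_vec psi) (hphi : unit_vec phi).

Definition convertible N M := exists Lam : {linear 'M[R[i]]_(d ^ N) -> 'M[R[i]]_(d ^ M)},
  CPTP Lam /\ covariant U Lam /\
  Lam (ntensmx (dens psi) N) = ntensmx (dens phi) M.

Lemma convertible_chi N M g : convertible N M ->
  `|chi U psi g| ^+ N <= `|chi U phi g| ^+ M.
Proof.
move=> [Lam [hL [hcov e]]]; rewrite -!dens_pvec in e.
rewrite -!normrX -!chi_pvec /chi -!mulmxA.
apply: (CPTP_overlap hL) => //; first exact: unit_pvec.
- have hM := proj_unitary_rep_ntensmx M hU.
  exact: (unitary_unit_vec g hM (unit_pvec M hphi)).
- by rewrite !dens_mul hcov e.
Qed.

(** The factor [#|gT|] is the size of the family of orbit vectors given to [gram_channel]. *)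
Lemma chi_convertible N M :
  (forall g, g != 1%g ->
    #|gT|%:R * `|chi U psi g| ^+ N <= `|chi U phi g| ^+ M) ->
  convertible N M.
Proof.
move=> hchi.
have hN := proj_unitary_rep_ntensmx N hU.
have hM := proj_unitary_rep_ntensmx M hU.
pose s (i : 'I_#|gT|) := ntensmx (U (enum_val i)) N *m pvec psi N.
pose t (i : 'I_#|gT|) := ntensmx (U (enum_val i)) M *m pvec phi M.
have [i|i|i j ij|Lam [hL Lst]] := @gram_channel R _ _ _ s t (enum_rank 1%g).
- exact: (unitary_unit_vec (enum_val i) hN (unit_pvec N hpsi)).
- exact: (unitary_unit_vec (enum_val i) hM (unit_pvec M hphi)).
- rewrite (norm_rep_overlap _ _ _ hN) (norm_rep_overlap _ _ _ hM) !chi_pvec !normrX.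
  apply: hchi; apply: contra ij => /eqP e; apply/eqP/enum_val_inj.
  by rewrite -[RHS](mulKVg (enum_val i)) e mulg1.
have [|Lam' [hL' Le hcov]] := twirl (rho := dens (pvec psi N))
    (sigma := dens (pvec phi M)) hN hM hL.
  by move=> g; have := Lst (enum_rank g); rewrite /s /t enum_rankK !dens_mul.
by exists Lam'; rewrite -!dens_pvec.
Qed.

(** A modulus with values in [R], where [ln] and the rate estimates live. *)
Definition modchi (v : 'cV[R[i]]_d) g : R := complex.Re `|chi U v g|.

Lemma modchiE v g : `|chi U v g| = real_complex _ (modchi v g).
Proof. by rewrite /modchi normc_def. Qed.

Lemma modchi_ge0 v g : 0 <= modchi v g.
Proof. by rewrite -ler0c -modchiE. Qed.

Lemma modchi_eq0 v g : (modchi v g == 0) = (chi U v g == 0).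
Proof. by rewrite -[RHS]normr_eq0 modchiE fmorph_eq0. Qed.

Lemma modchi_gt0 v g : chi U v g != 0 -> 0 < modchi v g.
Proof. by move=> h; rewrite lt_def modchi_eq0 h modchi_ge0. Qed.

Lemma modchi_phi_lt1 g : (forall g, Lfun U phi g = 0%E -> g = 1%g) ->
  g != 1%g -> modchi phi g < 1.
Proof.
move=> hL g1; rewrite lt_neqAle -lecR -modchiE rmorph1 norm_chi_le1 // andbT.
apply: contra g1 => /eqP e1; apply/eqP/hL; rewrite /Lfun -/(modchi phi g) e1 ln1.
by rewrite -modchi_eq0 e1 oner_eq0 oppr0.
Qed.

Lemma convertible_modchi N M g :
  convertible N M -> modchi psi g ^+ N <= modchi phi g ^+ M.
Proof.
by move=> /(convertible_chi g); rewrite !modchiE -!rmorphXn lecR.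
Qed.

Lemma modchi_convertible N M :
  (forall g, g != 1%g -> #|gT|%:R * modchi psi g ^+ N <= modchi phi g ^+ M) ->
  convertible N M.
Proof.
move=> h; apply: chi_convertible => g /h; rewrite !modchiE -!rmorphXn.
by rewrite -[#|gT|%:R in X in _ -> X](rmorph_nat (real_complex R)) -rmorphM lecR.
Qed.

(** Discard the input and prepare the state of the one-dimensional space [d ^ 0]. This makes rate 0
    achievable. *)
Lemma convertible0 N : convertible N 0.
Proof.
have [|Lam LamE] := linear_pack
    (f := fun X : 'M[R[i]]_(d ^ N) => \tr X *: dens (pvec phi 0)).
  by move=> a X Y; rewrite mxtraceD mxtraceZ scalerDl scalerA.
have trw : \tr (dens (pvec phi 0)) = 1.
  by rewrite mxtrace_mulC /mxtrace big_ord1; apply: unit_pvec.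
exists Lam; split; [split|split].
- by move=> X; rewrite LamE mxtraceZ trw mulr1.
- move=> k; apply: (CP_ext (f := fun X => \tr X *: dens (pvec phi 0))) => [X|].
    by rewrite LamE.
  exact: CP_trace.
- move=> g X; rewrite !LamE ntensmx0 hadj1 mul1mx mulmx1 mxtrace_mulC mulmxA.
  by rewrite ((proj_unitary_rep_ntensmx N hU).1 g).2 mul1mx.
- rewrite LamE -!dens_pvec mxtrace_mulC /mxtrace big_ord1.
  by rewrite (unit_pvec N hpsi) scale1r.
Qed.

End Conversion.

(** * Logarithmic estimates for rates *)

Section Rates.
Variable R : realType.

(** After taking logarithms, rounding costs at most [- ln b], whereas a rate above the ratio creates
    a deficit [N * delta] that grows without bound. *)
Lemma rate_le (a b r : R) N0 : 0 < a -> 0 < b < 1 ->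
  (forall N, (N0 < N)%N -> a ^+ N <= b ^+ Num.truncn (r * N%:R)) ->
  r <= - ln a / - ln b.
Proof.
move=> a0 /andP[b0 b1] h; have Lb : 0 < - ln b by rewrite oppr_gt0 ln_lt0 ?b0.
rewrite ler_pdivlMr // leNgt; apply/negP => lt_ab.
pose delta := r * - ln b - - ln a.
have d0 : 0 < delta by rewrite subr_gt0.
have [N ltN hN] : exists2 N, (N0 < N)%N & - ln b < N%:R * delta.
  exists (maxn N0 (Num.truncn (- ln b / delta))).+1; rewrite ?ltnS ?leq_maxl //.
  rewrite -ltr_pdivrMr // (lt_le_trans (truncnS_gt _)) // ler_nat ltnS.
  exact: leq_maxr.
have /(ler_wpM2r (ltW Lb)) := ltW (truncnS_gt (r * N%:R)).
have := h N ltN; move: (Num.truncn _) => M hM.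
have : ln (a ^+ N) <= ln (b ^+ M) by rewrite ler_ln ?posrE ?exprn_gt0.
rewrite !lnXn // -[ln a *+ _]mulr_natl -[ln b *+ _]mulr_natl -natr1.
move: hN; rewrite /delta => h1 h2 h3; lra.
Qed.

(** The logarithmic surplus [N * delta] eventually exceeds [ln k], and rounding the exponent down
    only helps as [b < 1]. *)
Lemma rate_lt_ge (k a b r : R) : 0 < k -> 0 <= r -> 0 < a -> 0 < b < 1 ->
  r < - ln a / - ln b ->
  exists N0, forall N, (N0 < N)%N -> k * a ^+ N <= b ^+ Num.truncn (r * N%:R).
Proof.
move=> k0 r0 a0 /andP[b0 b1]; have Lb : 0 < - ln b by rewrite oppr_gt0 ln_lt0 ?b0.
rewrite ltr_pdivlMr // => lt_ab.
pose delta := - ln a - r * - ln b.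
have d0 : 0 < delta by rewrite subr_gt0.
exists (Num.truncn (ln k / delta)) => N hN.
have hk : ln k < N%:R * delta.
  by rewrite -ltr_pdivrMr // (lt_le_trans (truncnS_gt _)) // ler_nat.
have : (Num.truncn (r * N%:R))%:R <= r * N%:R by rewrite truncn_le mulr_ge0.
move: (Num.truncn _) => M /(ler_wpM2r (ltW Lb)) hM.
suff : ln (k * a ^+ N) <= ln (b ^+ M).
  by rewrite ler_ln ?posrE ?mulr_gt0 ?exprn_gt0.
rewrite lnM ?posrE ?exprn_gt0 // !lnXn //.
rewrite -[ln a *+ _]mulr_natl -[ln b *+ _]mulr_natl.
move: hk; rewrite /delta => hk; lra.
Qed.
End Rates.

(** * The supremum of the achievable rates *)

Theorem theorem1 (R : realType) (gT : finGroupType) (d : nat)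
  (U : gT -> 'M[R[i]]_d) (psi phi : 'cV[R[i]]_d) :
  proj_unitary_rep U -> unit_vec psi -> unit_vec phi ->
  (forall g : gT, Lfun U phi g = 0%E -> g = 1%g) ->
  Rex U psi phi =
    (if Ginf U phi \subset Ginf U psi then
       \big[mine/+oo%E]_(g : gT | (g != 1%g) && (g \notin Ginf U phi))
          eratio (Lfun U psi g) (Lfun U phi g)
     else 0%E).
Proof.
move=> hU hpsi hphi hL.
have ach0 : achievable U psi phi 0.
  by split=> //; exists 0%N => N _; rewrite mul0r truncn0; exact: convertible0.
have sup0 : (0 <= Rex U psi phi)%E by apply: ereal_sup_ubound; exists 0.
have LfunE v g : chi U v g != 0 -> Lfun U v g = (- ln (modchi U v g))%:E.
  by rewrite /Lfun => /negbTE ->.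
case: ifPn => [hsub|/subsetPn[g]]; last first.
  rewrite !inE => phi0 psi0; apply/eqP; rewrite eq_le sup0 andbT.
  apply/ereal_supP => _ [r [r0 [N0 h]] <-]; rewrite lee_fin leNgt; apply/negP => r_gt0.
  (* At least one output copy is required: [0 ^+ 0 = 1] would give no contradiction. *)
  have [N ltN rN] : exists2 N, (N0 < N)%N & 1 <= r * N%:R.
    exists (maxn N0 (Num.truncn r^-1)).+1; rewrite ?ltnS ?leq_maxl //.
    rewrite mulrC -ler_pdivrMr // div1r ltW // (lt_le_trans (truncnS_gt _)) //.
    by rewrite ler_nat ltnS leq_maxr.
  have := convertible_modchi hU hphi g (h N ltN).
  have -> : modchi U phi g = 0 by apply/eqP; rewrite modchi_eq0.
  rewrite expr0n -[_ == 0%N]negbK -lt0n truncn_gt0 rN /= leNgt exprn_gt0 //.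
  exact: modchi_gt0.
have phi_lt1 g : g != 1%g -> modchi U phi g < 1 by exact: modchi_phi_lt1.
apply/eqP; rewrite eq_le; apply/andP; split.
  apply/ereal_supP => _ [r [r0 [N0 h]] <-].
  apply: le_bigmin => [|g /andP[g1]]; first exact: leey.
  rewrite inE => phi0; have [psi0|psi0] := eqVneq (chi U psi g) 0.
    by rewrite {1}/Lfun psi0 eqxx /= leey.
  rewrite !LfunE //= lee_fin; apply: (@rate_le _ _ _ _ N0).
  - exact: modchi_gt0.
  - by rewrite modchi_gt0 ?phi_lt1.
  - by move=> N /h hN; apply: (convertible_modchi hU hphi g); exact: hN.
have ach r : 0 < r -> (r%:E < \big[mine/+oo%E]_(g : gT |
    (g != 1%g) && (g \notin Ginf U phi)) eratio (Lfun U psi g) (Lfun U phi g))%E ->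
    achievable U psi phi r.
  move=> r0 /bigmin_gtP[_ hr]; split; first exact: ltW.
  (* Each [g] gets its own threshold; as the group is finite, their maximum serves all of them. *)
  have /choice[N0 hN0] g : exists N0, forall N, (N0 < N)%N -> g != 1%g ->
      #|gT|%:R * modchi U psi g ^+ N <= modchi U phi g ^+ Num.truncn (r * N%:R).
    have [->|g1] := eqVneq g 1%g; first by exists 0%N.
    have [psi0|psi0] := eqVneq (chi U psi g) 0.
      (* [N] is positive here, so [0 ^+ N] is 0. *)
      exists 0%N => N N0 _; have -> : modchi U psi g = 0.
        by apply/eqP; rewrite modchi_eq0 psi0.
      by rewrite expr0n gtn_eqF // mulr0 exprn_ge0 // modchi_ge0.
    have phi0 : chi U phi g != 0.
      by apply: contra psi0 => phi0; have := fintype.subsetP hsub g; rewrite !inE; apply.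
    have := hr g; rewrite g1 inE phi0 !LfunE //= => /(_ isT); rewrite lte_fin.
    move=> /(@rate_lt_ge R #|gT|%:R) [||||N0 hN0]; last by exists N0 => N /hN0.
    - by rewrite ltr0n; apply/card_gt0P; exists 1%g.
    - exact: ltW.
    - exact: modchi_gt0.
    - by rewrite modchi_gt0 ?phi_lt1.
  exists (\max_g N0 g)%N => N hN; apply: modchi_convertible => // g g1.
  by apply: hN0 => //; apply: leq_ltn_trans hN; exact: leq_bigmax.
(* If the minimum exceeded the supremum [s], some achievable rate would lie above [s]: the midpoint,
   or [s + 1] when the minimum is infinite, as for the trivial group. *)
rewrite leNgt; apply/negP; move: ach.
set x := \big[_/_]_(_ | _) _ => ach lt_sup.
have ub r : achievable U psi phi r -> (r%:E <= Rex U psi phi)%E.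
  by move=> hr; apply: ereal_sup_ubound; exists r.
case: (Rex U psi phi) sup0 lt_sup ub => [s|_|]; first last.
- by rewrite leeNy_eq.
- by rewrite ltNge leey.
rewrite lee_fin => s0.
case: x ach => [m| |] ach lt_sup ub; last by [].
  rewrite lte_fin in lt_sup; have := ub ((s + m) / 2); rewrite lee_fin.
  have : achievable U psi phi ((s + m) / 2) by apply: ach; rewrite ?lte_fin; lra.
  by move=> hr /(_ hr); lra.
have := ub (s + 1); rewrite lee_fin.
have : achievable U psi phi (s + 1) by apply: ach; rewrite ?ltry //; lra.
by move=> hr /(_ hr); lra.
Qed.
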